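(* For every $n\geq 1$, the path $P_n$ on $n$ vertices satisfies $F_d(P_n)=\lfloor n/3\rfloor+1$.
   Context: Zero forcing: given a set $B\subseteq V(G)$ of initially black vertices (all others white) of a finite simple graph $G$, at each step a black vertex having exactly one white neighbor forces that neighbor to become black; $B$ is a zero forcing set of $G$ if repeated application of this rule turns all vertices black. A set $D\subseteq V(G)$ is dominating if every vertex of $G$ is in $D$ or adjacent to a vertex of $D$. A dom-forcing set of $G$ is a set $D_f\subseteq V(G)$ that is both a dominating set of $G$ and a zero forcing set of $G$; the dom-forcing number $F_d(G)$ is the minimum cardinality of a dom-forcing set. *)

(* Defs.v *)
From mathcomp Require Import all_boot.

Set Implicit Arguments.
Unset Strict Implicit.
Unset Printing Implicit Defensive.

Record sgraph := SGraph {
  vertex :> finType;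
  adj : rel vertex;
  adj_sym : symmetric adj;
  adj_irr : irreflexive adj
}.

Section DomForcing.
Variable G : sgraph.
Implicit Types (B C D : {set G}) (u v : G).

Definition white_neighbors B u : {set G} := [set w | adj u w & w \notin B].

(* A single application of the colour-change rule takes the black set B to C. *)
Definition force_step : rel {set G} := fun B C =>
  [exists u in B, exists v, (white_neighbors B u == [set v]) && (C == v |: B)].

(* connect is the reflexive transitive closure. *)
Definition zero_forcing B : bool := connect force_step B [set: G].

Definition dominating D : bool :=
  [forall v, (v \in D) || [exists u in D, adj u v]].

Definition dom_forcing D : bool := dominating D && zero_forcing D.

(* The default setT of arg min is itself dom-forcing (dom_forcing_setT), so
   this is the minimum cardinality over all dom-forcing sets. *)
Definition dom_forcing_number : nat :=
  #|[arg min_(D < [set: G] | dom_forcing D) #|D|]|.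

Lemma dom_forcing_setT : dom_forcing [set: G].
Proof.
by rewrite /dom_forcing /zero_forcing connect0 andbT; apply/forallP => v; rewrite inE.
Qed.

Lemma dom_forcing_number_spec :
  (exists2 D, dom_forcing D & #|D| = dom_forcing_number) /\
  (forall D, dom_forcing D -> dom_forcing_number <= #|D|).
Proof.
rewrite /dom_forcing_number; case: arg_minnP => [|D hD minD].
  exact: dom_forcing_setT.
by split; [exists D | exact: minD].
Qed.

End DomForcing.

Definition path_adj (n : nat) : rel 'I_n :=
  fun i j => (i.+1 == j :> nat) || (j.+1 == i :> nat).

Lemma path_adj_sym n : symmetric (@path_adj n).
Proof. by move=> i j; rewrite /path_adj orbC. Qed.

Lemma path_adj_irr n : irreflexive (@path_adj n).
Proof. by move=> i; rewrite /path_adj orbb gtn_eqF. Qed.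

Definition path_graph (n : nat) : sgraph :=
  SGraph (@path_adj_sym n) (@path_adj_irr n).

(* Main.v *)
(** Lower bound: every vertex lies in [D] or is a white neighbour of [D], so
    [n] is at most [#|D|] plus the number of white neighbours of the vertices of
    [D].  In a path each vertex has at most two, and the vertex performing the
    first force has exactly one; hence [n < 3 * #|D|].

    Upper bound: any set containing an end vertex of a path forces it, and the
    vertices [0, 3, 6, ...] together with the last one, if [3 %| n], dominate. *)
Require Import Defs.
From mathcomp Require Import all_boot zify.

Set Implicit Arguments.
Unset Strict Implicit.
Unset Printing Implicit Defensive.

Lemma leq_card_bigcup (I T : finType) (A : {set I}) (F : I -> {set T}) :
  #|\bigcup_(i in A) F i| <= \sum_(i in A) #|F i|.
Proof.
elim/big_rec2: _ => [|i m B _ leBm]; first by rewrite cards0.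
by rewrite (leq_trans (leq_card_setU _ _)) // leq_add2l.
Qed.

Lemma dominating_card (G : sgraph) (D : {set G}) :
  dominating D -> #|G| <= #|D| + \sum_(u in D) #|white_neighbors D u|.
Proof.
move=> /forallP domD; rewrite -cardsT.
apply: leq_trans (leq_add (leqnn _) (leq_card_bigcup _ _)).
apply: leq_trans (leq_card_setU _ _); apply/subset_leq_card/subsetP => v _.
rewrite inE; have [//|vND] := boolP (v \in D).
have := domD v; rewrite (negbTE vND) => /exists_inP[u uD uv].
by apply/bigcupP; exists u; rewrite // inE uv.
Qed.

(** A forcing chain from a proper subset to the whole vertex set has at least one step; its first
    step, taken while the black set is still [D], supplies [u]. *)
Lemma zero_forcing_first_step (G : sgraph) (D : {set G}) :
  zero_forcing D -> D != [set: G] ->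
  exists2 u, u \in D & #|white_neighbors D u| = 1.
Proof.
move=> /connectP[[|C p] /= pDp lastp]; first by rewrite lastp eqxx.
case/andP: pDp => /exists_inP[u uD /existsP[v /andP[/eqP Wu _]]] _ _.
by exists u; rewrite // Wu cards1.
Qed.

Lemma card_white_neighbors_path n (D : {set path_graph n}) u :
  #|white_neighbors D u| <= 2.
Proof.
(* For [u = 0] the entry [u.-1] is spurious; the list only has to contain all neighbours. *)
have -> : 2 = size [:: u.-1; u.+1] by [].
rewrite cardE -(size_map val); apply: uniq_leq_size.
  by rewrite map_inj_uniq ?enum_uniq //; apply: val_inj.
move=> _ /mapP[w + ->]; rewrite mem_enum !inE /= /path_adj => /andP[uw _].
by lia.
Qed.

Lemma dom_forcing_path_card n (D : {set path_graph n}) :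
  0 < n -> dom_forcing D -> n < 3 * #|D|.
Proof.
move=> n_gt0 /andP[domD zfD].
have [->|DNT] := eqVneq D [set: path_graph n].
  by rewrite cardsT card_ord; lia.
have [u uD Wu] := zero_forcing_first_step zfD DNT.
have sumW : \sum_(x in D) #|white_neighbors D x| <= 1 + #|D :\ u| * 2.
  rewrite (big_setD1 u uD) Wu leq_add2l -sum_nat_const.
  by apply: leq_sum => x _; apply: card_white_neighbors_path.
have := dominating_card domD; rewrite [#|path_graph n|]card_ord.
(* The total is [#|D| + 1 + 2 * (#|D| - 1) = 3 * #|D| - 1]. *)
by move: sumW; rewrite (cardsD1 u D) uD; lia.
Qed.

(** Blackness sweeps along the path from [0]: by induction on [k], [D] reaches [D] together with the
    initial segment up to [k]. *)
Lemma zero_forcing_path_end n (D : {set path_graph n.+1}) :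
  ord0 \in D -> zero_forcing D.
Proof.
move=> D0; pose B k := D :|: [set i : path_graph n.+1 | i <= k].
suff DB k : connect (@force_step _) D (B k).
  rewrite /zero_forcing.
  suff <- : B n = [set: path_graph n.+1] by apply: DB.
  by apply/setP=> i; rewrite !inE -ltnS ltn_ord orbT.
elim: k => [|k IHk].
  suff -> : B 0 = D by apply: connect0.
  apply/setP=> i; rewrite !inE leqn0; case: eqP => [i0|]; last by rewrite orbF.
  by rewrite (_ : i = ord0) ?D0 //; apply: val_inj.
apply: connect_trans IHk _.
have [ltkn|lenk] := ltnP k.+1 n.+1; last first.
  suff -> : B k.+1 = B k by apply: connect0.
  by apply/setP=> i; rewrite !inE; have := ltn_ord i; lia.
pose u : path_graph n.+1 := Ordinal (ltnW ltkn).
pose v : path_graph n.+1 := Ordinal ltkn.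
have BS : B k.+1 = v |: B k.
  by apply/setP=> i; rewrite !inE -val_eqE /= leq_eqVlt ltnS orbCA.
have [vB|vNB] := boolP (v \in B k).
  by rewrite BS (setUidPr _) ?sub1set // connect0.
(* The vertex [u], of index [k], has its lower neighbour (if any) in [B k], so [v] is its only white
   neighbour. *)
apply/connect1/exists_inP; exists u; first by rewrite !inE leqnn orbT.
apply/existsP; exists v; rewrite BS eqxx andbT; apply/eqP/setP=> i.
rewrite in_set1; have [->|neq_iv] := eqVneq i v.
  by rewrite inE vNB /= /path_adj eqxx.
move: neq_iv; rewrite !inE -val_eqE /= /path_adj /=.
by case: (i \in D) => /=; lia.
Qed.

(** The last index is [n], so [minn] acts only if [3 %| n.+1]: the final multiple [n.+1] is then
    replaced by the end vertex [n]. *)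
Definition path_third_vertices n : {set path_graph n.+1} :=
  [set inord (minn (3 * i) n) | i : 'I_(n.+1 %/ 3 + 1)].

Lemma path_third_verticesP n k :
  k <= n.+1 %/ 3 -> inord (minn (3 * k) n) \in path_third_vertices n.
Proof.
move=> lek; have ltk : k < n.+1 %/ 3 + 1 by rewrite addn1.
by apply/imsetP; exists (Ordinal ltk).
Qed.

Lemma dominating_path_third_vertices n : dominating (path_third_vertices n).
Proof.
apply/forallP => v; have ltvn := ltn_ord v.
have [k lek near] : exists2 k, k <= n.+1 %/ 3 &
    [|| minn (3 * k) n == v, (minn (3 * k) n).+1 == v
      | v.+1 == minn (3 * k) n].
  (* This picks the multiple of 3 nearest to [v], since [3k-1], [3k] and [3k+1] all give [k]; if it
     exceeds [n], then [v = n] and the truncated value is [v] itself. *)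
  by exists (v.+1 %/ 3); lia.
have kD := path_third_verticesP lek.
have valk : (inord (minn (3 * k) n) : 'I_n.+1) = minn (3 * k) n :> nat.
  by rewrite inordK // ltnS geq_minr.
case/orP: near => [/eqP kv|near]; apply/orP.
  by left; rewrite -(inord_val v) -kv.
by right; apply/exists_inP; exists (inord (minn (3 * k) n));
   rewrite //= /path_adj valk.
Qed.

Lemma dom_forcing_path_third_vertices n : dom_forcing (path_third_vertices n).
Proof.
rewrite /dom_forcing dominating_path_third_vertices zero_forcing_path_end //.
have := @path_third_verticesP n 0 isT; rewrite muln0 min0n.
by rewrite (_ : inord 0 = ord0) //; apply: val_inj; rewrite /= inordK.
Qed.

Theorem theorem2p3 (n : nat) (hn : 1 <= n) :
  dom_forcing_number (path_graph n) = n %/ 3 + 1.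
Proof.
case: n hn => // n n_gt0.
have [[D domD <-] minD] := dom_forcing_number_spec (path_graph n.+1).
have := dom_forcing_path_card n_gt0 domD.
have := minD _ (dom_forcing_path_third_vertices n).
have : #|path_third_vertices n| <= n.+1 %/ 3 + 1.
  by rewrite (leq_trans (leq_imset_card _ _)) // card_ord.
by lia.
Qed.
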